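(* Let $K$ be a non-archimedean local field with finite residue field $\mathbb{F}_q$ of odd characteristic and ring of integers $\mathcal{O}_K$. Let $\mathcal{S}\subseteq\mathcal{O}_K[x]$ be a finite set of monic polynomials of degree two whose discriminants are all units in $\mathcal{O}_K$, regarded as an alphabet. Let $\mathcal{I}\subseteq\mathcal{S}^*$ be the language of all words $f_1f_2\cdots f_k\in\mathcal{S}^*$ such that $f_1\circ f_2\circ\cdots\circ f_k$ is irreducible in $K[x]$. Then $\mathcal{I}$ is a regular language.
   Context: $\mathcal{S}^*$ denotes the set of all finite words over the alphabet $\mathcal{S}$; a word $f_1\cdots f_k$ corresponds to the polynomial $f_1\circ\cdots\circ f_k$, and the empty word corresponds to $x$. A language over a finite alphabet is regular if it is accepted by a deterministic finite automaton; equivalently, if it is obtained from finite languages by finitely many applications of union, concatenation and Kleene star. *)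

(* Defs.v *)
From HB Require Import structures.
From mathcomp Require Import all_boot all_order all_algebra.
From mathcomp Require Import finmap.

Set Implicit Arguments.
Unset Strict Implicit.
Unset Printing Implicit Defensive.

Import Order.TTheory GRing.Theory Num.Theory.
Local Open Scope ring_scope.

(* Normalized discrete valuations K^* -> Z. The function is total on K, but its
   value at 0 is irrelevant: the convention v(0) = +oo is built into [val_ge]. *)
Record valuation (K : fieldType) := Valuation {
  vfun :> K -> int;
  valuationM : forall x y, x != 0 -> y != 0 -> vfun (x * y) = vfun x + vfun y;
  valuationD : forall x y, x != 0 -> y != 0 -> x + y != 0 ->
    Num.min (vfun x) (vfun y) <= vfun (x + y);
  valuation_uniformizer : exists2 pi, pi != 0 & vfun pi = 1
}.

(* v(x) >= n, where v(0) = +oo *)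
Definition val_ge (K : fieldType) (v : valuation K) (n : int) (x : K) : bool :=
  (x == 0) || (n <= v x).

Definition val_cauchy (K : fieldType) (v : valuation K) (u : nat -> K) : Prop :=
  forall n : int, exists N : nat, forall i j : nat,
    (N <= i)%N -> (N <= j)%N -> val_ge v n (u i - u j).

Definition val_converges (K : fieldType) (v : valuation K)
    (u : nat -> K) (l : K) : Prop :=
  forall n : int, exists N : nat, forall i : nat,
    (N <= i)%N -> val_ge v n (u i - l).

Definition val_complete (K : fieldType) (v : valuation K) : Prop :=
  forall u : nat -> K, val_cauchy v u -> exists l : K, val_converges v u l.

Section IntegerRing.
Variables (K : fieldType) (v : valuation K).

Definition integral_elt : {pred K} := [pred x | val_ge v 0 x].

Fact valuation1 : v 1 = 0.
Proof.
apply: (addrI (v 1)).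
by rewrite addr0 -valuationM ?oner_neq0 // mulr1.
Qed.

Fact valuationN x : x != 0 -> v (- x) = v x.
Proof.
have N1 : (-1 : K) != 0 by rewrite oppr_eq0 oner_neq0.
have vN1 : v (-1) = 0.
  have /eqP : v (-1) *+ 2 = 0.
    by rewrite mulr2n -valuationM // mulrNN mulr1 valuation1.
  by rewrite mulrn_eq0 => /eqP.
by move=> x0; rewrite -mulN1r valuationM // vN1 add0r.
Qed.

Fact integral_subring : subring_closed integral_elt.
Proof.
split.
- by rewrite !inE /val_ge valuation1 lexx orbT.
- move=> x y; rewrite !inE /val_ge.
  have [->|x0] := eqVneq x 0.
    have [->|y0] := eqVneq y 0; first by rewrite subrr eqxx.
    by rewrite sub0r oppr_eq0 (negPf y0) valuationN.
  have [->|y0] := eqVneq y 0; first by rewrite subr0 (negPf x0).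
  have [//|xy0 /= vx vy] := eqVneq (x - y) 0.
  have Ny0 : - y != 0 by rewrite oppr_eq0.
  apply: le_trans (valuationD v x0 Ny0 xy0).
  by rewrite le_min vx valuationN.
- move=> x y; rewrite !inE /val_ge mulf_eq0.
  have [->//|x0] := eqVneq x 0.
  have [->//|y0] := eqVneq y 0 => /= vx vy.
  by rewrite valuationM // addr_ge0.
Qed.

HB.instance Definition _ :=
  GRing.isSubringClosed.Build K integral_elt integral_subring.

Record integer_ring := IntegerRing {
  integer_val :> K;
  integer_valP : integer_val \in integral_elt
}.

HB.instance Definition _ := [isSub for integer_val].
HB.instance Definition _ := [Choice of integer_ring by <:].
HB.instance Definition _ := [SubChoice_isSubComNzRing of integer_ring by <:].

Definition integer_unit : {pred integer_ring} :=
  [pred x : integer_ring | (val x != 0) && ((val x)^-1 \in integral_elt)].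

Definition integer_inv (x : integer_ring) : integer_ring :=
  if x \in integer_unit then insubd x (val x)^-1 else x.

Fact integer_mulVr : {in integer_unit, left_inverse 1 integer_inv *%R}.
Proof.
move=> x ux; rewrite /integer_inv ux; move: ux => /andP[x0 xV].
by apply: val_inj; rewrite rmorphM rmorph1 /= val_insubd xV mulVf.
Qed.

Fact integer_unitPl (x y : integer_ring) : y * x = 1 -> integer_unit x.
Proof.
move=> /(congr1 val); rewrite rmorphM rmorph1 /= => yx.
have x0 : val x != 0.
  by apply: contra_eq_neq yx => ->; rewrite mulr0 eq_sym oner_neq0.
apply/andP; split=> //.
by rewrite -[_^-1]mul1r -yx mulfK // (valP y).
Qed.

Fact integer_invr_out : {in [predC integer_unit], integer_inv =1 id}.
Proof. by move=> x /negPf ux; rewrite /integer_inv ux. Qed.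

HB.instance Definition _ := GRing.ComNzRing_hasMulInverse.Build integer_ring
  integer_mulVr integer_unitPl integer_invr_out.

(* [red] presents [k] as the residue field: it is onto, and its kernel is the
   maximal ideal {x | v(x) >= 1}. *)
Definition residue_map (k : fieldType) (red : {rmorphism integer_ring -> k}) :
    Prop :=
  (forall a : k, exists x : integer_ring, red x = a) /\
  (forall x : integer_ring, red x = 0 <-> val_ge v 1 (val x)).

Definition to_field (f : {poly integer_ring}) : {poly K} :=
  map_poly (val : integer_ring -> K) f.

End IntegerRing.

Definition quadratic_discriminant (R : nzRingType) (f : {poly R}) : R :=
  f`_1 ^+ 2 - 4%:R * f`_2 * f`_0.

Definition word_poly (R : comNzRingType) (S : {fset {poly R}}) (w : seq S) :
    {poly R} :=
  foldr (fun (f : S) (g : {poly R}) => fsval f \Po g) 'X w.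

Record dfa (A : finType) := Dfa {
  dfa_state : finType;
  dfa_start : dfa_state;
  dfa_final : {set dfa_state};
  dfa_step : dfa_state -> A -> dfa_state
}.

Definition dfa_accept (A : finType) (M : dfa A) (w : seq A) : bool :=
  foldl (@dfa_step A M) (dfa_start M) w \in dfa_final M.

Definition regular (A : finType) (L : seq A -> Prop) : Prop :=
  exists M : dfa A, forall w : seq A, L w <-> dfa_accept M w.

(* Main.v *)
(* Complete the square: f = (X - a)^2 - b with b a unit. Up to translation,
   g o f is h(X^2) for h = g(X - b). If g is monic irreducible of degree n, then
   h(X^2) is reducible if and only if its root X in F[X]/(h) is a square there;
   reducibility always forces the norm (-1)^n g(-b) of that root to be a square
   in F, and conversely over a finite field. Over K, with the reduction of g
   still irreducible and g(-b) a unit, Hensel's lemma lifts a square root from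
   the residue field extension. As g(-b) can only vanish in the residue field
   when g = X, where b is a unit, induction on prefixes shows that a word is
   irreducible over K exactly when its reduction is irreducible over k. The
   latter is decided letter by letter from the values of g as a function k -> k,
   of which there are finitely many. *)
Require Import Defs.
From HB Require Import structures.
From mathcomp Require Import all_boot all_order all_algebra.
From mathcomp Require Import finmap.
From mathcomp Require Import cyclic finfield qfpoly ring zify.

Set Implicit Arguments.
Unset Strict Implicit.
Unset Printing Implicit Defensive.

Import Order.TTheory GRing.Theory Num.Theory.
Local Open Scope ring_scope.

(** * Irreducibility of g(X^2) *)

(** The truncated predecessor makes the formula cover the zero polynomial too. *)
Lemma size_comp_X2 (R : idomainType) (p : {poly R}) :
  size (p \Po 'X^2) = (size p).*2.-1.
Proof.
have [->|p0] := eqVneq p 0; first by rewrite comp_poly0 size_poly0.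
have := size_comp_poly p 'X^2; rewrite size_polyXn /=.
have : p \Po 'X^2 != 0 by rewrite comp_poly_eq0 ?size_polyXn.
move: p0; rewrite -!size_poly_gt0.
have aux a b : (0 < b -> 0 < a -> a.-1 = b.-1 * 2 -> a = b.*2.-1)%N by lia.
exact: aux.
Qed.

Section Square.
Variable F : fieldType.
Implicit Types g q p s : {poly F}.

(* [h] is the norm of [q] from F(X) to F(X^2). *)
Lemma exists_poly_norm q : exists h, h \Po 'X^2 = q * (q \Po (- 'X)).
Proof.
exists (even_poly q ^+ 2 - odd_poly q ^+ 2 * 'X).
have X2N : 'X^2 \Po (- 'X) = 'X^2 :> {poly F}.
  by rewrite rmorphXn /= comp_polyX sqrrN.
set e := even_poly q; set o := odd_poly q.
have qE : q = e \Po 'X^2 + (o \Po 'X^2) * 'X by rewrite poly_even_odd.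
have -> : q \Po (- 'X) = e \Po 'X^2 - (o \Po 'X^2) * 'X.
  by rewrite {1}qE comp_polyD comp_polyM -!comp_polyA X2N comp_polyX mulrN.
rewrite {1}qE !expr2 comp_polyB !comp_polyM comp_polyX -!expr2.
ring.
Qed.

(** The norm [h] of [q] has the degree of [q]. It is divisible by [g], for otherwise g(X^2) would be
    coprime to h(X^2) and hence to the common factor [q]. So [h] is a scalar multiple of [g], and
    comparing leading and constant coefficients gives the square. *)
Lemma dvdp_small_comp_X2 g q : g \is monic -> irreducible_poly g ->
    q %| g \Po 'X^2 -> (1 < size q <= size g)%N ->
  exists c, c ^+ 2 = (-1) ^+ (size g).-1 * g.[0].
Proof.
move=> g_monic g_irr q_dvd /andP[q_gt1 q_le].
have q0 : q != 0 by rewrite -size_poly_gt0 (ltn_trans _ q_gt1).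
have szN : size (- 'X : {poly F}) = 2%N by rewrite size_polyN size_polyX.
have szX2 : size ('X^2 : {poly F}) = 3%N by rewrite size_polyXn.
have [h hE] := exists_poly_norm q.
have q'0 : q \Po (- 'X) != 0 by rewrite comp_poly2_eq0.
have h0 : h != 0.
  have : h \Po 'X^2 != 0 by rewrite hE mulf_neq0.
  by apply: contra_neq => ->; rewrite comp_poly0.
have sz_h : size h = size q.
  have /(congr1 predn) := congr1 (size \o polyseq) hE.
  rewrite /= size_comp_poly szX2 size_mul // size_comp_poly2 //.
  move: h0 q_gt1; rewrite -size_poly_gt0.
  have aux a b : (0 < a -> 1 < b -> a.-1 * 3.-1 = (b + b).-2 -> a = b)%N by lia.
  exact: aux.
have lead_h : lead_coef h = lead_coef q ^+ 2 * (-1) ^+ (size q).-1.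
  have := congr1 lead_coef hE.
  rewrite lead_coefM !lead_coef_comp ?szN ?szX2 // lead_coefXn expr1n mulr1.
  by rewrite lead_coefN lead_coefX mulrA.
have g_dvd : g %| h.
  apply: contraTT q_gt1; rewrite -(irreducible_poly_coprime h g_irr).
  move=> /(coprimep_comp_poly 'X^2); rewrite hE => gh.
  have /coprimepP/(_ q q_dvd) := gh.
  by rewrite dvdp_mulr // -size_poly_eq1 => /(_ isT)/eqP->.
have gh_eqp : g %= h.
  by rewrite -(dvdp_size_eqp g_dvd) eqn_leq sz_h q_le -sz_h dvdp_leq.
have sz_gq : size g = size q by rewrite -sz_h; apply: eqp_size.
have hg : h = lead_coef h *: g.
  have /eqpP[[a b] /= /andP[a0 b0] ab] := gh_eqp.
  have := congr1 lead_coef ab; rewrite !lead_coefZ (monicP g_monic) mulr1 => abl.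
  by apply: (scalerI b0); rewrite scalerA -abl.
have : h.[0] = q.[0] ^+ 2.
  have := congr1 (horner^~ 0) hE.
  by rewrite hornerM !horner_comp !hornerE /= expr2 mul0r oppr0 -expr2.
rewrite hg hornerZ lead_h -sz_gq => gq.
have lq : lead_coef q ^+ 2 != 0 by rewrite expf_neq0 ?lead_coef_eq0.
exists (q.[0] / lead_coef q); rewrite expr_div_n -gq.
by rewrite -mulrA [_ ^+ 2 * _]mulrC mulfK.
Qed.

(** By [dvdp_small_comp_X2], two nonconstant factors would each have degree above deg g, too much
    for a product of degree 2 deg g. *)
Lemma irreducible_comp_X2 g : g \is monic -> irreducible_poly g ->
    (forall c, c ^+ 2 != (-1) ^+ (size g).-1 * g.[0]) ->
  irreducible_poly (g \Po 'X^2).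
Proof.
move=> g_monic g_irr nsq; have g_gt1 := g_irr.1.
have small q : q %| g \Po 'X^2 -> (1 < size q)%N -> (size g < size q)%N.
  move=> q_dvd q_gt1; rewrite ltnNge; apply/negP => q_le.
  have [|c cE] := dvdp_small_comp_X2 g_monic g_irr q_dvd; first by rewrite q_gt1.
  by have := nsq c; rewrite cE eqxx.
have two n : (1 < n -> 1 < n.*2.-1)%N by lia.
split=> [|q q1 q_dvd]; first by rewrite size_comp_X2 two.
have G0 : g \Po 'X^2 != 0 by rewrite -size_poly_gt0 size_comp_X2 ltnW // two.
have /dvdpP[r rq] := q_dvd.
have := G0; rewrite rq mulf_eq0 negb_or => /andP[r0 q0].
have r_dvd : r %| g \Po 'X^2 by rewrite rq dvdp_mulr.
have [r1|r1] := eqVneq (size r) 1%N.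
  by rewrite -{1}[q]mul1r eqp_mulr // eqp_sym -size_poly_eq1 r1.
have gt1 p : p != 0 -> size p != 1%N -> (1 < size p)%N.
  by rewrite -size_poly_gt0; case: (size p) => [|[]].
have := congr1 (size \o polyseq) rq; rewrite /= size_comp_X2 size_mul //.
have absurd n a b : (n < a -> n < b -> n.*2.-1 <> (a + b).-1)%N by lia.
by move/(absurd _ _ _ (small _ r_dvd (gt1 _ r0 r1)) (small _ q_dvd (gt1 _ q0 q1))).
Qed.

(** With [t] the remainder of [s], g(X^2) divides (t(X^2) - X)(t(X^2) + X); if irreducible, it would
    divide one of these factors. *)
Lemma sqrt_mod_reducible g s : g %| s ^+ 2 - 'X -> ~ irreducible_poly (g \Po 'X^2).
Proof.
move=> g_dvd [G_gt1 G_irr].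
have g_gt1 : (1 < size g)%N.
  by move: G_gt1; rewrite size_comp_X2; case: (size g) => [|[]].
have g0 : g != 0 by rewrite -size_poly_gt0 ltnW.
pose t := s %% g.
have {g_dvd} : g %| t ^+ 2 - 'X.
  have -> : t ^+ 2 - 'X = s ^+ 2 - 'X - (s %/ g) * (s + t) * g.
    by rewrite [in s ^+ 2](divp_eq s g) [in s + t](divp_eq s g) -/t; ring.
  by rewrite dvdp_sub // dvdp_mull.
(* The factors s(X^2) +- X below are nonzero, of degree less than 2 deg g. *)
have sz_t : (size t < size g)%N by rewrite ltn_modp.
have XsqE : (t \Po 'X^2) ^+ 2 - 'X^2 = (t ^+ 2 - 'X) \Po 'X^2.
  by rewrite comp_polyB rmorphXn /= comp_polyX.
move=> /(dvdp_comp_poly 'X^2); rewrite -XsqE subr_sqr => G_dvd.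
have G_irr' : irreducible_poly (g \Po 'X^2) by split.
have small (e : bool) : ~~ (g \Po 'X^2 %| (t \Po 'X^2) + (-1) ^+ e *: 'X).
  set r := _ + _.
  have r0 : r != 0.
    (* t(X^2) has only even exponents, so the coefficient of X is the sign. *)
    apply/eqP => /polyP /(_ 1%N); rewrite coefD coefZ coefX coef_comp_poly_Xn //=.
    by rewrite coef0 add0r mulr1 => /eqP; rewrite signr_eq0.
  apply/negP => /(dvdp_leq r0); apply/negP; rewrite -ltnNge.
  apply: leq_ltn_trans (size_polyD _ _) _.
  rewrite !size_comp_X2 size_scale ?signr_eq0 // size_polyX gtn_max.
  have aux m n : (1 < n -> m < n -> (m.*2.-1 < n.*2.-1) && (2 < n.*2.-1))%N by lia.
  exact: aux.
have := small false; have := small true; rewrite expr1 expr0 scaleN1r scale1r.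
move=> /negPf sF /negPf sT; move: G_dvd.
rewrite Gauss_dvdpr ?sT // (irreducible_poly_coprime _ G_irr') sF //.
Qed.

End Square.

(** * Square roots modulo an irreducible polynomial over a finite field *)

Lemma pchar_nat_card (k : finFieldType) : [pchar k].-nat #|k|.
Proof.
have [p p_pr pk] := finPcharP k.
rewrite (eq_pnat _ (pcharf_eq pk)) (card_pprimeChar pk : #|k| = _).
by rewrite pnatX pnat_id.
Qed.

(** Euler's criterion: if x = z^i with [z] a generator of the cyclic group of units, the hypothesis
    forces i to be even. *)
Lemma sqrt_of_expf_half (L : finFieldType) (x : L) : odd #|L| -> x != 0 ->
  x ^+ (#|L|.-1)./2 = 1 -> exists y, y ^+ 2 = x.
Proof.
move=> oddL x0 xN.
have L_gt1 : (1 < #|L|)%N := card_finNzRing_gt1 L.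
have expL (y : L) : y != 0 -> y ^+ #|L|.-1 = 1.
  move=> y0; apply: (mulfI y0).
  by rewrite -exprS prednK ?expf_card ?mulr1 // ltnW.
have [z /= _ z_prim] : exists2 z : L, z \in enum [pred y : L | y != 0]
    & (#|L|.-1).-primitive_root z.
  apply/hasP/cyclic.has_prim_root; first by case: #|L| L_gt1 => [|[]].
  - by apply/allP=> y; rewrite mem_enum inE unity_rootE => /expL->.
  - exact: enum_uniq.
  - by rewrite -cardE cardC1.
have [i xi] := prim_rootP z_prim (expL x x0).
move: xN; rewrite xi -exprM => /eqP; rewrite -(prim_order_dvd z_prim).
have E2 : #|L|.-1 = (#|L|.-1./2 * 2)%N.
  by case: #|L| oddL => //= n; rewrite muln2 => /negbTE n2;
    rewrite -[LHS]odd_double_half n2.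
rewrite {1}E2 mulnC dvdn_pmul2r; last by lia.
by case/dvdnP=> j ij; exists (z ^+ j); rewrite -exprM ij.
Qed.

(** * Conjugates and norms in an extension of finite fields *)

Section FrobeniusNorm.
Variables (k L : finFieldType) (emb : {rmorphism k -> L}) (z : L).
Local Notation q := #|k|.

Lemma pchar_morph_nat : [pchar L].-nat q.
Proof. by rewrite (eq_pnat _ (fmorph_pchar emb)) pchar_nat_card. Qed.

(** Raising to the power q is additive on [L] and fixes the image of [k]. *)
Lemma horner_map_expf_card (p : {poly k}) (y : L) i :
  (map_poly emb p).[y] ^+ (q ^ i) = (map_poly emb p).[y ^+ (q ^ i)].
Proof.
have step (x : L) : (map_poly emb p).[x] ^+ q = (map_poly emb p).[x ^+ q].
  have qD : {morph (fun x : L => x ^+ q) : x y / x + y}.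
    by move=> a b; rewrite exprDn_pchar ?pchar_morph_nat.
  have q0 : (0 : L) ^+ q = 0 by rewrite expr0n gtn_eqF // ltnW ?card_finNzRing_gt1.
  rewrite !horner_coef (big_morph _ qD q0); apply: eq_bigr => j _.
  by rewrite exprMn coef_map -rmorphXn /= expf_card exprAC.
elim: i => [|i IH]; first by rewrite !expr1.
by rewrite expnSr exprM IH step -exprM.
Qed.

Variables (g : {poly k}).
Hypothesis g_monic : g \is monic.
Hypothesis cardL : #|L| = (q ^ (size g).-1)%N.
Hypothesis g_root : root (map_poly emb g) z.
Hypothesis z_gen : forall x, exists p, x = (map_poly emb p).[z].

(** As [z] generates [L], a shorter orbit would make every element of [L] a root of X^(q^d) - X,
    whose degree is below #|L|. *)
Lemma frobenius_orbit_neq d : (0 < d < (size g).-1)%N -> z ^+ (q ^ d) != z.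
Proof.
move=> /andP[d0 d_lt]; apply/eqP => zd.
have q_gt1 : (1 < q)%N := card_finNzRing_gt1 k.
have fixL (x : L) : x ^+ (q ^ d) = x.
  by have [p ->] := z_gen x; rewrite horner_map_expf_card zd.
have qd : (1 < q ^ d)%N by rewrite -{1}(expn0 q) ltn_exp2l.
have szP : size ('X^(q ^ d) - 'X : {poly L}) = (q ^ d).+1.
  by rewrite size_polyDl size_polyXn // size_polyN size_polyX.
have P0 : 'X^(q ^ d) - 'X != 0 :> {poly L} by rewrite -size_poly_gt0 szP.
have := max_poly_roots P0 (_ : all _ (enum L)) (enum_uniq L).
rewrite szP -cardE cardL ltnS leq_exp2l // leqNgt d_lt => abs.
apply: notF; apply: abs; apply/allP => x _.
by rewrite rootE !hornerE fixL subrr.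
Qed.

(** The conjugates of [z] are deg g distinct roots of [g], hence all of them. *)
Lemma map_poly_frobenius_prod :
  map_poly emb g = \prod_(i < (size g).-1) ('X - (z ^+ (q ^ i))%:P).
Proof.
set n := (size g).-1; have q_gt1 : (1 < q)%N := card_finNzRing_gt1 k.
have fix_z : z ^+ (q ^ n) = z by rewrite -cardL expf_card.
pose rs := mkseq (fun i => z ^+ (q ^ i)) n.
have uniq_rs : uniq rs.
  apply/mkseq_uniqP => i j; rewrite !inE.
  wlog le_ij : i j / (i <= j)%N.
    by move=> IH; case/orP: (leq_total i j) => [|le_ji] ? ? ?; [|apply/esym]; apply: IH.
  (* Raising to the power q^(n - i) turns a coincidence of two conjugates into z^(q^(j - i)) = z. *)
  move=> lt_in lt_jn /(congr1 (fun x => x ^+ (q ^ (n - i)))).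
  rewrite -!exprM -!expnD subnKC 1?ltnW // fix_z.
  have -> : (j + (n - i) = n + (j - i))%N by lia.
  rewrite expnD exprM fix_z => /esym/eqP z_fix.
  apply/eqP; rewrite eqn_leq le_ij /= -subn_eq0 -leqn0 leqNgt.
  apply: contraTN z_fix => lt_0; apply: frobenius_orbit_neq.
  by rewrite lt_0 -/n (leq_ltn_trans _ lt_jn) ?leq_subr.
have sz_g : size (map_poly emb g) = (size rs).+1.
  rewrite size_map_poly size_mkseq prednK // size_poly_gt0.
  exact: monic_neq0.
rewrite (all_roots_prod_XsubC sz_g) ?uniq_rootsE //; last first.
  apply/allP=> _ /mapP[i _ ->]; rewrite rootE -horner_map_expf_card.
  by rewrite (eqP g_root) expr0n expn_eq0 gtn_eqF // ltnW.
rewrite lead_coef_map (monicP g_monic) rmorph1 scale1r big_map.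
by rewrite -{1}[n]subn0 -/(index_iota 0 n) big_mkord.
Qed.

(** Both sides are the norm of [z]: evaluate the factorization of [g] into conjugates at 0. *)
Lemma expf_frobenius_norm :
  z ^+ (\sum_(i < (size g).-1) q ^ i) = emb ((-1) ^+ (size g).-1 * g.[0]).
Proof.
rewrite rmorphM rmorphXn rmorphN1 -horner_map rmorph0 map_poly_frobenius_prod.
rewrite horner_prod -[X in (-1) ^+ X]card_ord -prodr_const -big_split /=.
by rewrite expr_sum; apply: eq_bigr => i _; rewrite !hornerE mulN1r opprK.
Qed.

(** Since (#|L| - 1)/2 = (1 + q + ... + q^(n-1)) (q - 1)/2, the corresponding power of [z] is
    N(z)^((q-1)/2) = c^(q-1) = 1, and Euler's criterion applies. *)
Lemma root_sqrt (c : k) : odd q -> g.[0] != 0 ->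
  c ^+ 2 = (-1) ^+ (size g).-1 * g.[0] -> exists y, y ^+ 2 = z.
Proof.
move=> oddq g0 cE; set n := (size g).-1 in cE *.
have oddL : odd #|L| by rewrite cardL oddX oddq orbT.
have c0 : c != 0.
  apply: contraNneq g0 => c0; move/eqP: cE.
  by rewrite c0 expr0n eq_sym mulf_eq0 signr_eq0.
have z0 : z != 0.
  apply: contraNneq g0 => z0; move: g_root.
  by rewrite z0 -(rmorph0 emb) fmorph_root.
apply: sqrt_of_expf_half => //.
have -> : (#|L|.-1./2 = (\sum_(i < n) q ^ i) * q.-1./2)%N.
  rewrite cardL predn_exp mulnC.
  have -> : q.-1 = (q.-1./2).*2 by rewrite even_halfK //; case: q oddq.
  by rewrite -doubleMr doubleK doubleK.
rewrite exprM expf_frobenius_norm -/n -cE -rmorphXn -exprM mul2n even_halfK; last first.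
  by case: q oddq.
rewrite (_ : c ^+ _ = 1) ?rmorph1 //; apply: (mulfI c0).
by rewrite -exprS prednK ?expf_card ?mulr1 //; case: q oddq.
Qed.

End FrobeniusNorm.

(** Take [L] = k[X]/(g) and the class of X for [z], then represent the square root in [L] by a
    polynomial. *)
Lemma finField_sqrt_mod (k : finFieldType) (g : {poly k}) (c : k) : odd #|k| ->
    g \is monic -> irreducible_poly g -> c ^+ 2 = (-1) ^+ (size g).-1 * g.[0] ->
  exists s, g %| s ^+ 2 - 'X.
Proof.
move=> oddk g_monic g_irr cE.
(* Euler's criterion concerns nonzero elements; if g(0) = 0, then [g] is associate to X and s = 0
   works. *)
have [g0|g0] := eqVneq g.[0] 0.
  have gX : 'X %= g.
    apply: (apply_irredp g_irr); first by rewrite size_polyX.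
    by rewrite -['X]subr0 dvdp_XsubCl rootE g0.
  by exists 0; rewrite expr0n sub0r dvdpNr -(eqp_dvdl 'X gX) dvdpp.
have hI : monic_irreducible_poly g by split.
pose L : finFieldType := {poly %/ g with hI}.
pose emb : {rmorphism k -> L} := qpolyC g.
have in_qpolyE (p : {poly k}) : (map_poly emb p).['qX] = in_qpoly g p.
  by rewrite -[RHS]/(in_qpoly g p) -{2}[p]comp_polyXr in_qpoly_comp_horner.
have g_root : root (map_poly emb g) ('qX : L).
  apply/eqP; rewrite in_qpolyE; apply: val_inj => /=.
  by rewrite mk_monicE // Pdiv.RingMonic.rmodpp.
have z_gen (x : L) : exists p, x = (map_poly emb p).['qX].
  exists (x : {poly k}); rewrite in_qpolyE; apply: val_inj => /=.
  by rewrite Pdiv.Ring.rmodp_small // size_mk_monic.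
have [y yE] := root_sqrt g_monic (card_qfpoly hI) g_root z_gen oddk g0 cE.
have [s sE] := z_gen y; exists s.
(* Otherwise [g] would be coprime to s^2 - X, yet both vanish at the class of X. *)
apply: contraTT (g_root); rewrite -(irreducible_poly_coprime _ g_irr) => g_cop.
rewrite rootE; apply: (coprimep_root (p := map_poly emb (s ^+ 2 - 'X))).
  by rewrite coprimep_sym coprimep_map.
by rewrite rootE rmorphB rmorphXn /= map_polyX hornerD hornerN hornerX horner_exp
  -sE yE subrr.
Qed.

(** * Lifting square roots over the ring of integers *)

(* Newton iteration with the derivative frozen at its initial value [2 * u0]. *)
Lemma sqrt_approximations (A : comNzRingType) (w y u0 t : A) :
    (exists c, u0 ^+ 2 - y = w * c) -> (exists c, 2%:R * u0 * t - 1 = w * c) ->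
  exists u : nat -> A, u 0%N = u0 /\ forall m,
    (exists c, u m ^+ 2 - y = w ^+ m.+1 * c) /\
    (exists c, u m.+1 - u m = w ^+ m.+1 * c).
Proof.
move=> [c0 c0E] [d dE]; pose step x := x - t * (x ^+ 2 - y).
exists (fun m => iter m step u0); split=> // m.
(* Staying congruent to [u0] modulo [w] keeps [t] an inverse of twice the iterate modulo [w], so
   each step gains a factor [w]. *)
suff [[c cE] _] : (exists c, iter m step u0 ^+ 2 - y = w ^+ m.+1 * c) /\
    (exists c, iter m step u0 - u0 = w * c).
  split; first by exists c.
  by exists (- t * c); rewrite iterS {1}/step cE; ring.
elim: m => [|m [[c cE] [e eE]]].
  by split; [exists c0; rewrite expr1|exists 0; rewrite subrr mulr0].
rewrite iterS; set x := iter m step u0 in cE eE *; split.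
  exists (- c * (d + 2%:R * t * e) + t ^+ 2 * c ^+ 2 * w ^+ m).
  have -> : step x ^+ 2 - y = (x ^+ 2 - y) * (1 - 2%:R * t * x)
      + t ^+ 2 * (x ^+ 2 - y) ^+ 2.
    by rewrite /step; ring.
  have -> : 1 - 2%:R * t * x = - (2%:R * u0 * t - 1) - 2%:R * t * (x - u0) by ring.
  by rewrite cE dE eE !exprS; ring.
exists (e - t * w ^+ m * c).
have -> : step x - u0 = (x - u0) - t * (x ^+ 2 - y) by rewrite /step; ring.
by rewrite eE cE exprS; ring.
Qed.

Lemma poly_of_coefs (R : nzRingType) n (P : nat -> R -> Prop) :
    (forall i, (i < n)%N -> exists x, P i x) ->
  exists p : {poly R}, (size p <= n)%N /\ forall i, (i < n)%N -> P i p`_i.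
Proof.
move=> Pex; have [F FP] := fin_all_exists (fun i : 'I_n => Pex i (ltn_ord i)).
exists (\poly_(i < n) if insub i is Some j then F j else 0).
split=> [|i lt_in]; first exact: size_poly.
by rewrite coef_poly lt_in insubT; apply: (FP (Ordinal lt_in)).
Qed.

Section IntegerRing.
Variables (K : fieldType) (v : valuation K).
Local Notation O := (integer_ring v).

Lemma exists_uniformizer : exists w : O, val w != 0 /\ v (val w) = 1.
Proof.
have [w w0 vw] := valuation_uniformizer v.
have wO : w \in integral_elt v by rewrite inE /val_ge vw orbT.
by exists (IntegerRing wO).
Qed.

Variable w : O.
Hypotheses (w0 : val w != 0) (vw : v (val w) = 1).

Lemma valuationX n : v (val w ^+ n) = n.
Proof.
elim: n => [|n IH]; first by rewrite expr0 valuation1.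
by rewrite exprS valuationM ?expf_neq0 // vw IH.
Qed.

(** Dividing by w^n lowers the valuation by n, so bounds on valuations become divisibility in the
    ring of integers. *)
Lemma val_geP (n : nat) (x : K) :
  reflect (exists c : O, x = val (w ^+ n * c)) (val_ge v n x).
Proof.
have wn0 : val w ^+ n != 0 by rewrite expf_neq0.
apply: (iffP idP) => [xn | [c ->]]; last first.
  rewrite /val_ge rmorphM rmorphXn mulf_eq0 (negPf wn0) /=.
  have [//|c0 /=] := eqVneq (val c) 0.
  have := valP c; rewrite inE /val_ge (negPf c0) /= => vc.
  by rewrite valuationM // valuationX lerDl.
have cO : x / val w ^+ n \in integral_elt v.
  move: xn; rewrite inE /val_ge; have [->|x0 /= vx] := eqVneq x 0.
    by rewrite mul0r eqxx.
  have y0 : x / val w ^+ n != 0 by rewrite mulf_neq0 ?invr_eq0.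
  rewrite (negPf y0) /= -(lerD2l n%:Z) addr0 -{2}(valuationX n) -valuationM //.
  by rewrite mulrC divfK.
by exists (IntegerRing cO); rewrite rmorphM rmorphXn /= mulrC divfK.
Qed.

(** The valuation of a nonzero such [x] would exceed itself. *)
Lemma integer_separated (x : O) :
  (forall n, exists c, x = w ^+ n * c) -> x = 0.
Proof.
move=> xw; apply: val_inj; rewrite rmorph0; apply/eqP/negPn/negP => x0.
have [c xc] := xw `|v (val x)|.+1%N.
have /val_geP : exists c : O, val x = val (w ^+ `|v (val x)|.+1%N * c).
  by exists c; rewrite -xc.
by rewrite /val_ge (negPf x0) /=; lia.
Qed.

(** The step estimates add up to a Cauchy condition. The limit, taken in [K], differs from u_0 by a
    multiple of [w], so it is integral. *)
Lemma integer_complete (u : nat -> O) : val_complete v ->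
    (forall n, exists c, u n.+1 - u n = w ^+ n.+1 * c) ->
  exists l, forall n, exists c, l - u n = w ^+ n.+1 * c.
Proof.
move=> K_complete u_step.
have u_tail n i : (n <= i)%N -> exists c, u i - u n = w ^+ n.+1 * c.
  move=> /subnKC<-; elim: (i - n)%N => [|m [c cE]].
    by exists 0; rewrite addn0 subrr mulr0.
  have [d dE] := u_step (n + m)%N.
  exists (w ^+ m * d + c); rewrite addnS mulrDr mulrA -exprD addSn -dE -cE.
  by rewrite addrA subrK.
have [|l ul] := K_complete (fun n => val (u n)).
  move=> z; exists `|z|%N => i j /u_tail[c cE] /u_tail[d dE].
  suff : val_ge v `|z|%N (val (u i) - val (u j)).
    by rewrite /val_ge => /orP[->//|zl]; apply/orP; right; apply: le_trans zl; lia.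
  apply/val_geP; exists (w * (c - d)); rewrite -rmorphB; congr (val _).
  by rewrite mulrA -exprSr mulrBr -cE -dE; ring.
have tail n : exists c : O, l - val (u n) = val (w ^+ n.+1 * c).
  have [N /(_ (maxn N n) (leq_maxl _ _))] := ul n.+1.
  move/val_geP => [c cE]; have [d dE] := u_tail n _ (leq_maxr N n).
  exists (d - c).
  transitivity (val (u (maxn N n)) - val (u n) - (val (u (maxn N n)) - l)).
    by ring.
  by rewrite cE mulrBr -dE !rmorphB.
have [c0 c0E] := tail 0%N; exists (u 0%N + w ^+ 1 * c0) => n.
have lE : val (u 0%N + w ^+ 1 * c0) = l.
  by rewrite rmorphD -[l](subrK (val (u 0%N))) c0E addrC.
have [c cE] := tail n; exists c; apply: val_inj; rewrite -cE -lE.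
exact: rmorphB.
Qed.

(** Newton iteration in O[X]/(g), with [t] inverting 2 s0 modulo [w]. As [g] is monic, classes have
    representatives of degree below deg g, whose coefficients converge in [O]; the limit squares to
    X modulo every power of [w], hence exactly. *)
Lemma hensel_sqrt_mod (g s0 t : {poly O}) : val_complete v ->
    g \is monic -> (1 < size g)%N ->
    (exists q c, s0 ^+ 2 - 'X = q * g + w *: c) ->
    (exists q c, 2%:R * s0 * t - 1 = q * g + w *: c) ->
  exists s q, s ^+ 2 - 'X = q * g.
Proof.
move=> K_complete g_monic g_gt1 [q1 [c1 E1]] [q2 [c2 E2]].
have mkg : mk_monic g = g by rewrite /mk_monic g_gt1 g_monic.
pose A := {poly %/ g}; pose pi : {poly O} -> A := in_qpoly g.
have pi_mod q (c : {poly O}) : pi (q * g + w *: c) = w%:A * pi c.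
  rewrite /pi rmorphD rmorphM /= in_qpolyZ.
  have -> : in_qpoly g g = 0.
    by apply: val_inj; rewrite /= mkg Pdiv.RingMonic.rmodpp.
  by rewrite mulr0 add0r -[in RHS]scalerAl mul1r.
have pi_id (x : A) : pi (x : {poly O}) = x.
  by apply: val_inj; rewrite /= Pdiv.Ring.rmodp_small // size_mk_monic.
have wA n (x : A) : (w%:A : A) ^+ n * x = w ^+ n *: x.
  by rewrite exprZn expr1n -scalerAl mul1r.
have [||u [_ uE]] := @sqrt_approximations A w%:A (pi 'X) (pi s0) (pi t).
- by exists (pi c1); rewrite -(pi_mod q1) -E1 /pi rmorphB rmorphXn.
- by exists (pi c2); rewrite -(pi_mod q2) -E2 /pi rmorphB !rmorphM rmorph_nat rmorph1.
pose n := (size g).-1.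
have sz_u m : (size (u m : {poly O}) <= n)%N.
  rewrite -ltnS prednK ?(ltnW g_gt1) //; apply: leq_trans (size_mk_monic (u m)) _.
  by rewrite mkg.
have [i _|s [sz_s sE]] := @poly_of_coefs O n (fun i l => forall m, exists c,
    l - (u m : {poly O})`_i = w ^+ m.+1 * c).
  apply: integer_complete => // m; have [_ [c cE]] := uE m.
  by exists ((c : {poly O})`_i); rewrite -coefB -coefZ -poly_of_qpolyZ -wA -cE.
exists s, (Pdiv.Ring.rdivp (s ^+ 2 - 'X) g).
(* The remainder in the division by the monic [g] represents the class of s^2 - X. *)
rewrite {1}(Pdiv.RingMonic.rdivp_eq g_monic (s ^+ 2 - 'X)).
suff pi0 : pi (s ^+ 2 - 'X) = 0.
  by have := congr1 (fun x : A => x : {poly O}) pi0; rewrite /= mkg => ->; rewrite addr0.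
have pi_s m : exists c : A, pi (s ^+ 2 - 'X) = w ^+ m *: c.
  have [C [sz_C CE]] := @poly_of_coefs O n
    (fun i c => s`_i - (u m : {poly O})`_i = w ^+ m.+1 * c) (fun i lt_in => sE i lt_in m).
  have {CE} CE : s = (u m : {poly O}) + w ^+ m.+1 *: C.
    apply/polyP => i; rewrite coefD coefZ.
    have [lt_in|le_ni] := ltnP i n; first by rewrite -CE // addrC subrK.
    by rewrite !nth_default ?mulr0 ?addr0 // (leq_trans _ le_ni).
  have {CE} pisE : pi s = u m + w ^+ m.+1 *: pi C.
    by rewrite {1}CE /pi rmorphD /= in_qpolyZ -/(pi (u m)) pi_id.
  have [[c cE] _] := uE m.
  exists (w *: (c + pi C * (2%:R * u m + w ^+ m.+1 *: pi C))).
  rewrite scalerA -exprSr /pi rmorphB rmorphXn /= -/(pi s) pisE -!wA.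
  rewrite mulrDr -cE; ring.
apply: val_inj; apply/polyP => i; rewrite coef0; apply: integer_separated => m.
have [c ->] := pi_s m; exists ((c : {poly O})`_i).
by rewrite -coefZ.
Qed.

End IntegerRing.

(** * Composition with a quadratic polynomial *)

Section CompQuadratic.
Variable F : fieldType.
Implicit Types f g : {poly F}.

Lemma irredp_X : irreducible_poly ('X : {poly F}).
Proof. by rewrite -['X]subr0; apply: irredp_XsubC. Qed.

(** Translation is invertible, so divisors can be translated back. *)
Lemma irreducible_comp_XaddC g c :
  irreducible_poly g -> irreducible_poly (g \Po ('X + c%:P)).
Proof.
move=> [g_gt1 g_irr]; split=> [|q q1 q_dvd].
  by rewrite size_comp_poly2 // size_XaddC.
have gK : (g \Po ('X + c%:P)) \Po ('X - c%:P) = g := comp_polyXaddC_K g c.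
have qK : (q \Po ('X - c%:P)) \Po ('X + c%:P) = q.
  by have := comp_polyXaddC_K q (- c); rewrite polyCN opprK.
have /andP[_] : q \Po ('X - c%:P) %= g.
  apply: g_irr; first by rewrite size_comp_poly2 ?size_XsubC.
  by rewrite -gK dvdp_comp_poly.
by move/(dvdp_comp_poly ('X + c%:P)); rewrite qK /eqp q_dvd.
Qed.

(** A proper factor of [g] composes to a proper factor of g o f. Thus a word with a reducible prefix
    stays reducible. *)
Lemma irreducible_of_comp f g : (1 < size f)%N ->
  irreducible_poly (g \Po f) -> irreducible_poly g.
Proof.
move=> f_gt1 [gf_gt1 gf_irr]; have sz := size_comp_poly g f.
have g_gt1 : (1 < size g)%N.
  by move: gf_gt1 sz; case: (size g) => [|[|//]]; rewrite mul0n; case: (size _) => [|[]].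
split=> // q q1 q_dvd.
have g0 : g != 0 by rewrite -size_poly_gt0 ltnW.
have q0 : q != 0 by apply: contraNneq g0 => q0; rewrite -dvd0p -q0.
have q_gt1 : (1 < size q)%N.
  by move: q0 q1; rewrite -size_poly_gt0; case: (size q) => [|[]].
have f1 : (0 < (size f).-1)%N by case: (size f) f_gt1 => [|[]].
have szq := size_comp_poly q f.
have : q \Po f %= g \Po f.
  apply: gf_irr; last exact: dvdp_comp_poly.
  apply/eqP => qf1; move: szq; rewrite qf1 /= => /esym/eqP.
  by rewrite muln_eq0 gtn_eqF -?lt0n ?gtn_eqF // -ltnS prednK // ltnW.
move/eqp_size/(congr1 predn); rewrite szq sz => /eqP.
rewrite eqn_pmul2r // -(dvdp_size_eqp q_dvd) => /eqP qg.
by rewrite -(prednK (ltnW q_gt1)) -(prednK (ltnW g_gt1)) qg.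
Qed.

Lemma comp_quadratic (R : comNzRingType) (g : {poly R}) a b :
  g \Po (('X - a%:P) ^+ 2 - b%:P) = ((g \Po ('X - b%:P)) \Po 'X^2) \Po ('X - a%:P).
Proof. by rewrite -!comp_polyA comp_polyB comp_polyX comp_polyC comp_Xn_poly. Qed.

Lemma irreducible_comp_quadratic g a b : g \is monic -> irreducible_poly g ->
    (forall c, c ^+ 2 != (-1) ^+ (size g).-1 * g.[- b]) ->
  irreducible_poly (g \Po (('X - a%:P) ^+ 2 - b%:P)).
Proof.
move=> g_monic g_irr nsq; rewrite comp_quadratic -polyCN.
apply/irreducible_comp_XaddC/irreducible_comp_X2.
- by rewrite monicE lead_coef_comp ?size_XsubC // (monicP g_monic) mul1r
    lead_coefXsubC expr1n.
- by rewrite -polyCN; apply: irreducible_comp_XaddC.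
- move=> c; rewrite size_comp_poly2 ?size_XsubC // horner_comp !hornerE.
  by rewrite nsq.
Qed.

Lemma reducible_comp_quadratic g s a b :
    g \Po ('X - b%:P) %| s ^+ 2 - 'X ->
  ~ irreducible_poly (g \Po (('X - a%:P) ^+ 2 - b%:P)).
Proof.
move=> g_dvd /(irreducible_comp_XaddC a).
have := comp_polyXaddC_K ((g \Po ('X - b%:P)) \Po 'X^2) (- a).
rewrite polyCN opprK -comp_quadratic => ->.
exact: sqrt_mod_reducible g_dvd.
Qed.

End CompQuadratic.

(** * Embedding into K and reduction to the residue field *)

Lemma size_monic_map (R S : nzRingType) (h : {rmorphism R -> S}) (p : {poly R}) :
  p \is monic -> size (map_poly h p) = size p.
Proof. by move=> /monicP p1; rewrite size_map_poly_id0 // p1 rmorph1 oner_neq0. Qed.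

Section Residue.
Variables (K : fieldType) (v : valuation K).
Local Notation O := (integer_ring v).

Lemma to_fieldB (p q : {poly O}) : to_field (p - q) = to_field p - to_field q.
Proof. exact: rmorphB. Qed.

Lemma to_fieldM (p q : {poly O}) : to_field (p * q) = to_field p * to_field q.
Proof. exact: rmorphM. Qed.

Lemma to_fieldC (a : O) : to_field a%:P = (val a)%:P.
Proof. exact: map_polyC. Qed.

Lemma to_fieldX : to_field ('X : {poly O}) = 'X.
Proof. exact: (map_polyX (val : {rmorphism O -> K})). Qed.

Lemma to_field_monic (p : {poly O}) : (to_field p \is monic) = (p \is monic).
Proof. by rewrite !monicE /to_field (lead_coef_map_inj val_inj). Qed.

Lemma size_to_field (p : {poly O}) : size (to_field p) = size p.
Proof. by rewrite (size_map_inj_poly val_inj). Qed.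

Lemma to_field_comp (p q : {poly O}) : to_field (p \Po q) = to_field p \Po to_field q.
Proof. exact: map_comp_poly. Qed.

(** Transferred from K[x], as the embedding preserves sizes and leading coefficients. *)
Lemma monic_comp_integer (p q : {poly O}) : p \is monic -> q \is monic ->
    (1 < size q)%N ->
  p \Po q \is monic /\ (size (p \Po q)).-1 = ((size p).-1 * (size q).-1)%N.
Proof.
rewrite -!to_field_monic to_field_comp -!size_to_field to_field_comp size_comp_poly.
move=> p1 q1 q_gt1; split=> //.
by rewrite monicE lead_coef_comp // (monicP p1) (monicP q1) mul1r expr1n.
Qed.

Variables (k : fieldType) (red : {rmorphism O -> k}).
Hypothesis red_residue : residue_map red.

(** Outside the maximal ideal the valuation is 0, so the inverse is integral. *)
Lemma integer_unit_red (x : O) : red x != 0 -> x \is a GRing.unit.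
Proof.
move=> rx; have x1 : ~~ val_ge v 1 (val x).
  by apply: contra rx => /red_residue.2 ->.
have := valP x; rewrite inE; move: x1; rewrite /val_ge negb_or => /andP[x0 vx1].
rewrite (negPf x0) /= => vx0; apply/andP; split=> //; apply/orP; right.
have := valuationM v x0 (_ : (val x)^-1 != 0).
rewrite invr_eq0 divff // valuation1 => /(_ x0) /=.
move: vx0 vx1 => /=; lia.
Qed.

Variable w : O.
Hypotheses (w0 : val w != 0) (vw : v (val w) = 1).

Lemma red_eq0P (x : O) : red x = 0 <-> exists c, x = w * c.
Proof.
rewrite red_residue.2; split=> [/(val_geP w0 vw 1)[c xc] | [c ->]].
  by exists c; apply: val_inj; rewrite xc expr1.
by apply/(val_geP w0 vw 1); exists c; rewrite expr1.
Qed.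

Lemma map_red_surj (p : {poly k}) : exists P : {poly O}, map_poly red P = p.
Proof.
have [i _|P [szP PE]] := @poly_of_coefs O (size p) (fun i x => red x = p`_i).
  exact: red_residue.1.
exists P; apply/polyP => i; rewrite coef_map /=.
have [/PE //|le_pi] := ltnP i (size p).
by rewrite !nth_default ?rmorph0 // (leq_trans szP).
Qed.

Lemma map_red_eq0 (P : {poly O}) : map_poly red P = 0 -> exists C, P = w *: C.
Proof.
move=> P0; have [i _|C [szC CE]] := @poly_of_coefs O (size P) (fun i c => P`_i = w * c).
  by apply/red_eq0P; rewrite -coef_map P0 coef0.
exists C; apply/polyP => i; rewrite coefZ.
have [/CE //|le_pi] := ltnP i (size P).
by rewrite !nth_default ?mulr0 // (leq_trans szC).
Qed.

(** Hensel's lemma needs 2s invertible modulo the reduction of [g]. If that reduction divided [s],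
    it would divide X and so vanish at 0. *)
Lemma residue_sqrt_lift (g : {poly O}) (s : {poly k}) : val_complete v ->
    2%:R != 0 :> k -> g \is monic -> irreducible_poly (map_poly red g) ->
    (map_poly red g).[0] != 0 -> map_poly red g %| s ^+ 2 - 'X ->
  exists S Q, S ^+ 2 - 'X = Q * g.
Proof.
move=> K_complete k2 g_monic g_irr g0 /dvdpP[q sq].
have g_gt1 : (1 < size g)%N by rewrite -(size_monic_map red g_monic) g_irr.1.
have g_cop : coprimep (map_poly red g) s.
  rewrite irreducible_poly_coprime //; apply: contra g0 => g_s.
  have g_X : map_poly red g %| 'X.
    have -> : 'X = s * s - q * map_poly red g by rewrite -sq; ring.
    by apply: dvdp_sub; [exact: dvdp_mulr | exact: dvdp_mull].
  have := apply_irredp (irredp_X k) _ g_X; rewrite gtn_eqF ?g_irr.1 // => /(_ isT).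
  by move=> /eqp_root/(_ 0); rewrite /root hornerX eqxx.
have /Bezout_eq1_coprimepP[[a t] /= at1] := g_cop.
have [S0 S0E] := map_red_surj s; have [Q0 Q0E] := map_red_surj q.
(* From the Bezout relation a g + t s = 1, t/2 inverts the derivative 2s modulo [g], with 2s (t/2) -
   1 = - a g. *)
have [T TE] := map_red_surj (2%:R^-1 *: t); have [A AE] := map_red_surj (- a).
apply: (@hensel_sqrt_mod _ _ w w0 vw g S0 T) => //.
  have [C CE] : exists C, S0 ^+ 2 - 'X - Q0 * g = w *: C.
    apply: map_red_eq0; rewrite !rmorphB rmorphXn rmorphM /= map_polyX S0E Q0E.
    by rewrite sq subrr.
  by exists Q0, C; rewrite -CE [RHS]addrC subrK.
have [C CE] : exists C, 2%:R * S0 * T - 1 - A * g = w *: C.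
  apply: map_red_eq0; rewrite !rmorphB !rmorphM rmorph1 rmorph_nat /= S0E TE AE.
  have -> : 2%:R * s * (2%:R^-1 *: t) = t * s.
    by rewrite -scalerAr -mulrA mulr_natl -scaler_nat scalerA mulVf // scale1r mulrC.
  by rewrite mulNr opprK addrAC [t * s + _]addrC at1 subrr.
by exists A, C; rewrite -CE [RHS]addrC subrK.
Qed.

End Residue.

(** * The automaton *)

(** The zero of the derivative when [f] is a monic quadratic. *)
Definition critical_point (R : unitRingType) (f : {poly R}) : R := - f`_1 / 2%:R.

(** The second identity turns a unit discriminant into a unit critical value. *)
Lemma complete_square (R : comUnitRingType) (f : {poly R}) (a := critical_point f) :
    f \is monic -> size f = 3%N -> 2%:R \is a @GRing.unit R ->
  f = ('X - a%:P) ^+ 2 - (- f.[a])%:P /\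
  quadratic_discriminant f = - (4%:R * f.[a]).
Proof.
move=> f_monic f3 u2.
have f2 : f`_2 = 1 by rewrite -(monicP f_monic) lead_coefE f3.
have a2 : a * 2%:R = - f`_1 by rewrite divrK.
have f1 : f`_1 = - (a * 2%:R) by rewrite a2 opprK.
have fa : f.[a] = f`_0 - a ^+ 2.
  rewrite horner_coef f3 !big_ord_recr big_ord0 /= f2 f1; ring.
split; last by rewrite /quadratic_discriminant fa f2 f1; ring.
have -> : ('X - a%:P) ^+ 2 - (- f.[a])%:P = 'X^2 + f`_1 *: 'X + (f`_0)%:P.
  have sq (A C Y : {poly R}) : (Y - A) ^+ 2 - - (C - A ^+ 2) =
      Y ^+ 2 + - (A * 2%:R) * Y + C.
    by ring.
  by rewrite fa f1 -mul_polyC !polyCN polyCB rmorphXn /= (polyCM a) polyC_natr sq.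
apply/polyP => i; rewrite !coefD coefZ coefXn coefX coefC.
case: i => [|[|[|i]]] /=; rewrite ?f2 ?mulr0 ?mulr1 ?add0r ?addr0 //.
by rewrite nth_default // f3.
Qed.

Section Automaton.
Variables (K : fieldType) (v : valuation K) (K_complete : val_complete v).
Variables (k : finFieldType) (red : {rmorphism integer_ring v -> k}).
Hypothesis red_residue : residue_map red.
Hypothesis k2 : 2%:R != 0 :> k.
Local Notation O := (integer_ring v).
Local Notation redp := (map_poly red).

Lemma integer_unit2 : (2%:R : O) \is a GRing.unit.
Proof. by apply: (integer_unit_red red_residue); rewrite rmorph_nat. Qed.

Lemma odd_card_residue : odd #|k|.
Proof.
have [p p_pr pk] := finPcharP k.
have p_odd : odd p.
  case: (even_prime p_pr) => // p2; move: k2.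
  by rewrite -p2 pcharf0 ?eqxx.
have /p_natP[n ->] : p.-nat #|k| by rewrite -(eq_pnat _ (pcharf_eq pk)) pchar_nat_card.
by rewrite oddX p_odd orbT.
Qed.

Lemma red_critical_point (f : {poly O}) :
  red (critical_point f) = critical_point (redp f).
Proof.
rewrite /critical_point rmorphM rmorphN rmorphV ?integer_unit2 // rmorph_nat.
by rewrite coef_map.
Qed.

(** Here [t] is the residue of g(f(a)), with a the critical point. If its signed value is not a
    square in [k], neither is that of g(f(a)) in [K], and both composites stay irreducible. If it is
    a nonzero square, a square root of X modulo the translate [h] of [g] lifts by Hensel's lemma and
    splits g o f over [K]. *)
Lemma irreducible_comp_step (f g : {poly O}) (n := (size g).-1)
    (t := (redp g).[(redp f).[critical_point (redp f)]]) :
    f \is monic -> size f = 3%N -> g \is monic ->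
    irreducible_poly (redp g) -> irreducible_poly (to_field g) ->
  [/\ (forall c, c ^+ 2 != (-1) ^+ n * t) ->
      irreducible_poly (redp (g \Po f)) /\ irreducible_poly (to_field (g \Po f))
    & (exists c, c ^+ 2 = (-1) ^+ n * t) -> t != 0 ->
      ~ irreducible_poly (to_field (g \Po f))].
Proof.
move=> f_monic f3 g_monic g_irr gK_irr.
have [] := complete_square f_monic f3 integer_unit2; set a := critical_point f => fE _.
pose b := - f.[a]; rewrite -/b in fE.
have szg : size (redp g) = size g by exact: size_monic_map.
have szgK : size (to_field g) = size g by exact: size_to_field.
have gb : g.[- b] = g.[f.[a]] by rewrite opprK.
have tE : t = red g.[- b].
  by rewrite gb -!horner_map red_critical_point.
have redb : (redp g).[- red b] = t by rewrite tE -rmorphN horner_map.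
have valb : (to_field g).[- val b] = val g.[- b].
  by rewrite -[- val b](rmorphN (val : O -> K)) /to_field horner_map.
have gfk : redp (g \Po f) = redp g \Po (('X - (red a)%:P) ^+ 2 - (red b)%:P).
  by rewrite map_comp_poly fE rmorphB rmorphXn rmorphB /= map_polyX !map_polyC.
have gfK : to_field (g \Po f) = to_field g \Po (('X - (val a)%:P) ^+ 2 - (val b)%:P).
  rewrite to_field_comp fE; congr (_ \Po _).
  by rewrite !expr2 to_fieldB to_fieldM to_fieldB to_fieldX !to_fieldC.
split=> [nsq | [c cE] t0].
  split.
    rewrite gfk; apply: irreducible_comp_quadratic => //; first exact: monic_map.
    by rewrite szg redb.
  rewrite gfK; apply: irreducible_comp_quadratic => //; first by rewrite to_field_monic.
  move=> c; rewrite szgK valb; apply/eqP => cE.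
  (* A square root of an integral element is integral, so it has a residue, which contradicts
     [nsq]. *)
  have cO : c \in integral_elt v.
    have : c ^+ 2 \in integral_elt v.
      by rewrite cE rpredM ?rpredX ?rpredN1 // (valP g.[- b]).
    rewrite !inE /val_ge expf_eq0 /=; have [//|c0 /=] := eqVneq c 0.
    by rewrite expr2 valuationM //; lia.
  have cE' : (IntegerRing cO) ^+ 2 = (-1) ^+ n * g.[- b].
    apply: val_inj; rewrite [LHS]rmorphXn [RHS]rmorphM rmorphXn rmorphN1.
    exact: cE.
  have := nsq (red (IntegerRing cO)); rewrite -rmorphXn cE'.
  by rewrite rmorphM rmorphXn rmorphN1 -tE eqxx.
pose h := g \Po ('X - b%:P).
have [h_monic szh] : h \is monic /\ size h = size g.
  have [|h_monic hE] := monic_comp_integer g_monic (monicXsubC b).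
    by rewrite size_XsubC.
  split=> //; rewrite -(size_to_field h) to_field_comp size_comp_poly2 //.
  by rewrite size_to_field size_XsubC.
have hk : redp h = redp g \Po ('X - (red b)%:P).
  by rewrite map_comp_poly rmorphB /= map_polyX map_polyC.
have hk_irr : irreducible_poly (redp h).
  by rewrite hk -polyCN; apply: irreducible_comp_XaddC.
have h0 : (redp h).[0] = t by rewrite hk horner_comp !hornerE.
have [s s_dvd] : exists s, redp h %| s ^+ 2 - 'X.
  apply: (@finField_sqrt_mod _ _ c odd_card_residue) => //; first exact: monic_map.
  by rewrite h0 size_monic_map // szh.
have [w [w0 vw]] := exists_uniformizer v.
have [|S [Q SQ]] :=
  residue_sqrt_lift red_residue w0 vw K_complete k2 h_monic hk_irr _ s_dvd.
  by rewrite h0.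
rewrite gfK; apply: (@reducible_comp_quadratic _ _ (to_field S)).
have -> : to_field g \Po ('X - (val b)%:P) = to_field h.
  by rewrite to_field_comp to_fieldB to_fieldX to_fieldC.
apply/dvdpP; exists (to_field Q).
by rewrite -to_fieldM -SQ to_fieldB !expr2 to_fieldM to_fieldX.
Qed.

(* For the word polynomial [g] read so far, the state records whether [g] is
   irreducible, whether the word is nonempty, which fixes the sign (-1)^(deg g),
   and the values of [g] on the residue field. *)
Definition residue_step (st : bool * bool * {ffun k -> k}) (f : {poly k}) :=
  let t := st.2 f.[critical_point f] in
  (st.1.1 && [forall c, c ^+ 2 != if st.1.2 then t else - t], true,
   [ffun x => st.2 f.[x]]).

Variable S : {fset {poly O}}.
Hypothesis S_monic : forall f, f \in S -> f \is monic.
Hypothesis S_deg2 : forall f, f \in S -> size f = 3%N.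
Hypothesis S_disc : forall f, f \in S -> quadratic_discriminant f \is a GRing.unit.

(** The start state describes X: irreducible, empty word, identity function. *)
Definition residue_run (w : seq S) :=
  foldl (fun st (f : S) => residue_step st (redp (fsval f)))
    (true, false, [ffun x => x]) w.

(** Reading a letter on the right substitutes it on the inside, which is the step g to g o f. *)
Lemma word_poly_rcons (w : seq S) (f : S) :
  word_poly (rcons w f) = word_poly w \Po fsval f.
Proof.
elim: w => [|h w IH] /=; first by rewrite comp_polyX comp_polyXr.
by rewrite IH comp_polyA.
Qed.

Lemma word_poly_monic (w : seq S) :
  word_poly w \is monic /\ size (word_poly w) = (2 ^ size w).+1.
Proof.
elim/last_ind: w => [|w f [w_monic szw]]; first by rewrite monicX size_polyX.
rewrite word_poly_rcons size_rcons.
have f_S : fsval f \in S := fsvalP f.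
have [|wf_monic] := monic_comp_integer w_monic (S_monic f_S).
  by rewrite (S_deg2 f_S).
rewrite szw (S_deg2 f_S) /= -expnSr => sz; split=> //.
by rewrite -sz prednK // size_poly_gt0 monic_neq0.
Qed.

(** A set flag records irreducibility over both fields, as the next step requires; a cleared flag
    records its failure over [K], which persists by [irreducible_of_comp]. *)
Lemma residue_runP (w : seq S) (st := residue_run w) :
  [/\ st.1.2 = (w != [::]), forall x, st.2 x = (redp (word_poly w)).[x]
    & if st.1.1 then irreducible_poly (redp (word_poly w)) /\
                     irreducible_poly (to_field (word_poly w))
      else ~ irreducible_poly (to_field (word_poly w))].
Proof.
rewrite {}/st; elim/last_ind: w => [|w f].
  split=> //= [x|]; first by rewrite ffunE map_polyX hornerX.
  by rewrite to_fieldX map_polyX; split; apply: irredp_X.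
rewrite /residue_run -cats1 foldl_cat /= -/(residue_run w) cats1.
case: (residue_run w) => [[alive ne] F] /= [-> FE irr].
have f_S : fsval f \in S := fsvalP f.
have [w_monic szw] := word_poly_monic w.
rewrite word_poly_rcons; split=> [|x|].
- by case: (w).
- by rewrite ffunE FE map_comp_poly horner_comp.
case: alive irr => /= [[irr irrK] | irrK]; last first.
  by move=> /[!to_field_comp]/irreducible_of_comp;
    rewrite size_to_field S_deg2 // => /(_ isT).
have [alive dead] := irreducible_comp_step (S_monic f_S) (S_deg2 f_S) w_monic irr irrK.
rewrite FE; set t := _.[_] in alive dead *.
(* The degree 2^|w| is odd only for the empty word. *)
have signE : (if w != [::] then t else - t) = (-1) ^+ (size (word_poly w)).-1 * t.
  rewrite szw /=; case: (w) => [|h w'] /=; first by rewrite expn0 expr1 mulN1r.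
  by rewrite expnS exprM sqrrN expr1n expr1n mul1r.
rewrite signE; case: ifPn => [/forallP/alive // | /forallPn[c /negPn/eqP cE]].
apply: dead; first by exists c.
(* It remains to see that [t] is nonzero. For the empty word it is the residue of f(a), a unit since
   the discriminant is -4 f(a). *)
case: (eqVneq w [::]) => [w0|w0].
  have := (complete_square (S_monic f_S) (S_deg2 f_S) integer_unit2).2.
  move: (S_disc f_S) => /[swap]->; rewrite unitrN unitrM => /andP[_ fa_unit].
  rewrite /t w0 /= map_polyX hornerX -red_critical_point horner_map -unitfE.
  exact: rmorph_unit.
(* For a nonempty word, t = 0 would give a linear factor of an irreducible polynomial of degree at
   least two. *)
apply/negP; rewrite -[t == 0]/(root _ _) -dvdp_XsubCl.
move/(apply_irredp irr); rewrite size_XsubC => /(_ isT)/eqp_size.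
rewrite size_XsubC size_monic_map // szw.
by case: (w) w0 => //= h w' _; rewrite expnS;
  case: (2 ^ _)%N (expn_gt0 2 (size w')) => //= m _ []; lia.
Qed.

End Automaton.

Theorem corollary4p3
  (K : fieldType) (v : valuation K) (K_complete : val_complete v)
  (k : finFieldType) (red : {rmorphism integer_ring v -> k})
  (red_residue : residue_map red)
  (p : nat) (char_k : p \in [pchar k]) (p_odd : odd p)
  (S : {fset {poly integer_ring v}})
  (S_monic : forall f, f \in S -> f \is monic)
  (S_deg2 : forall f, f \in S -> size f = 3%N)
  (S_disc : forall f, f \in S -> quadratic_discriminant f \is a GRing.unit) :
  regular (fun w : seq S => irreducible_poly (to_field (word_poly w))).
Proof.
have k2 : 2%:R != 0 :> k.
  rewrite -(dvdn_pcharf char_k) dvdn_prime2 ?(pcharf_prime char_k) //.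
  by apply: contraTneq p_odd => ->.
exists (Dfa (true, false, [ffun x => x]) [set st : bool * bool * {ffun k -> k} | st.1.1]
         (fun st (f : S) => residue_step st (map_poly red (fsval f)))) => w.
rewrite /dfa_accept inE /= -/(residue_run red w).
have [_ _] := residue_runP K_complete red_residue k2 S_monic S_deg2 S_disc w.
by case: (residue_run red w).1.1 => [[]|].
Qed.
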